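(* Let $L$ be a finite-dimensional left Leibniz algebra over a field $F$ generated as an algebra by a single element $a$, so that $L$ has basis $a, a^2, \dots, a^n$ (with $n = \dim L \geq 1$), and let $V$, $B$, $k$, $r_1,\dots,r_k$ and $U_{s_1,\dots,s_k}$ be as defined in the context. Then the $U_{s_1, \dots, s_k}$ (with $0 \le s_i \le r_i$ for $i=1,\dots,k$) are the only subalgebras of $L$ not contained in $V$. The lattice interval $L \div B$ is the lattice product of $k$ chains of lengths $r_1, \dots, r_k$.
   Context: A left Leibniz algebra over $F$ is an $F$-vector space with a bilinear product satisfying $x(yz) = (xy)z + y(xz)$. Powers are defined by $a^1=a$, $a^{i+1} = a\,a^i$. Setting: $L$ is generated by $a$ and has basis $a, a^2, \dots, a^n$. Put $V = \langle a^2, \dots, a^n \rangle$ (linear span), and let $\theta : V \to V$ be left multiplication by $a$, $\theta(v) = av$. The space $V$ is generated as an $F[\theta]$-module by $a^2$. Let $f(x)$ be the characteristic polynomial of $\theta$ (which is also its minimum polynomial), and write $f(x) = x^r g(x)$ with $g(0) \neq 0$. Put $h(x) = \bigl(g(x) - g(0)\bigr)/(x\,g(0))$ and $b = a + h(\theta)a^2$; then $b^{r+2} = 0$. Let $B$ be the subalgebra of $L$ generated by $b$. Let $g(x) = p_1(x)^{r_1} \cdots p_k(x)^{r_k}$ be the prime power factorisation of $g$, where the $p_i(x)$ are distinct irreducible polynomials over $F$ and $r_i \ge 1$. For integers $0 \le s_i \le r_i$ put $$V_{s_1, \dots, s_k} = \{v \in V \mid p_1(\theta)^{s_1} \cdots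 p_k(\theta)^{s_k} v = 0\}, \qquad U_{s_1, \dots, s_k} = B + V_{s_1, \dots, s_k}.$$ For subalgebras $A \supseteq C$ of $L$, $A \div C$ denotes the lattice interval of all subalgebras $D$ with $A \supseteq D \supseteq C$. A chain of length $r$ is a totally ordered set with $r+1$ elements. *)

(* Defs.v *)
From HB Require Import structures.
From mathcomp Require Import all_boot all_order all_algebra.

Set Implicit Arguments.
Unset Strict Implicit.
Unset Printing Implicit Defensive.

Import GRing.Theory.
Local Open Scope ring_scope.

Section Algebra.
Variables (F : fieldType) (L : vectType F) (mul : {bilinear L -> L -> L}).

Definition left_leibniz : Prop :=
  forall x y z : L, mul x (mul y z) = mul (mul x y) z + mul y (mul x z).

Definition subalgebra (D : {vspace L}) : Prop :=
  forall x y : L, x \in D -> y \in D -> mul x y \in D.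

(* [A] is the smallest subalgebra containing [X]; it exists and is unique, see
   [generated_exists] and [generated_unique]. *)
Definition generated (X A : {vspace L}) : Prop :=
  [/\ subalgebra A, (X <= A)%VS
    & forall D : {vspace L}, subalgebra D -> (X <= D)%VS -> (A <= D)%VS].

Lemma generated_unique X A A' : generated X A -> generated X A' -> A = A'.
Proof.
move=> [sA XA minA] [sA' XA' minA'].
by apply: subv_anti; rewrite minA // minA'.
Qed.

Lemma generated_exists X : exists A, generated X A.
Proof.
have [m] := ubnP (\dim {:L} - \dim X)%N.
elim: m X => // m IHm X ltm.
pose bX : seq L := vbasis X.
have [cl | /allPn[x xX /allPn[y yX nXxy]]] :=
  boolP (all (fun x => all (fun y => mul x y \in X) bX) bX).
  exists X; split=> // x y Xx Xy.
  rewrite (coord_vbasis Xx) linear_sumlz memv_suml // => i _.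
  rewrite linearZl_LR memvZ // (coord_vbasis Xy) linear_sumr memv_suml // => j _.
  rewrite linearZr_LR memvZ //.
  by move: cl => /allP/(_ _ (mem_nth 0 _))/allP/(_ _ (mem_nth 0 _)); apply;
    rewrite size_tuple.
have XX' : (X <= X + <[mul x y]>)%VS by apply: addvSl.
have ltX : (\dim X < \dim (X + <[mul x y]>))%N.
  rewrite ltn_neqAle dimvS // andbT; apply: contra nXxy => /eqP eX.
  have /eqP-> : X == (X + <[mul x y]>)%VS by rewrite eqEdim XX' eX /=.
  by rewrite memvE addvSr.
have [|A [sA XA minA]] := IHm (X + <[mul x y]>)%VS.
  have leL : (\dim (X + <[mul x y]>) <= \dim {:L})%N by rewrite dimvS ?subvf.
  apply: leq_trans (_ : _ <= m)%N; last exact: ltm.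
  by rewrite ltn_sub2l // (leq_trans ltX).
exists A; split=> // [|D sD XD]; first exact: subv_trans XX' XA.
apply: minA => //; rewrite subv_add XD -memvE.
by apply: sD; apply: (subvP XD); apply: vbasis_mem.
Qed.

(* Membership of [D] in the lattice interval of subalgebras from [C] up to [A]. *)
Definition interval (A C D : {vspace L}) : Prop :=
  [/\ subalgebra D, (C <= D)%VS & (D <= A)%VS].

(* A chain of length [m] is the ordinal type ['I_m.+1], whose lattice operations
   are [minn] and [maxn]; in the lattice of subalgebras the meet is the
   intersection and the join is the subalgebra generated by the sum. *)
Definition interval_iso_prod_chains (A C : {vspace L}) (k : nat)
    (l : 'I_k -> nat) : Prop :=
  exists phi : {dffun forall i : 'I_k, 'I_(l i).+1} -> {vspace L},
  [/\ forall s, interval A C (phi s),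
      forall D, interval A C D -> exists s, phi s = D,
      injective phi,
      forall s t u : {dffun forall i : 'I_k, 'I_(l i).+1},
        (forall i, u i = minn (s i) (t i) :> nat) ->
        phi u = (phi s :&: phi t)%VS
    & forall s t u : {dffun forall i : 'I_k, 'I_(l i).+1},
        (forall i, u i = maxn (s i) (t i) :> nat) ->
        generated (phi s + phi t)%VS (phi u)].

(* [lpow a i] is a^i for i >= 1. *)
Definition lpow (a : L) (i : nat) : L := iter i.-1 (mul a) a.

End Algebra.

Section Operators.
Variables (F : fieldType) (U : vectType F).

(* ['End(U)] has no canonical ring structure in MathComp because [U] may be
   zero, so powers and polynomials of an operator are spelled out. *)
Definition lfun_exp (T : 'End(U)) (n : nat) : 'End(U) :=
  iter n (comp_lfun T) \1%VF.

Definition lfun_horner (p : {poly F}) (T : 'End(U)) : 'End(U) :=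
  \sum_(i < size p) p`_i *: lfun_exp T i.

(* [mxof] acts on row vectors, i.e. it is the transpose of the usual matrix of
   [T]; the characteristic polynomial det(xI - T) is the same. *)
Definition lfun_char_poly (T : 'End(U)) : {poly F} :=
  char_poly (passmx.mxof (vbasis {:U}) (vbasis {:U}) T).

End Operators.

Section Cyclic.
Variables (F : fieldType) (L : vectType F) (mul : {bilinear L -> L -> L}).
Variable a : L.

Definition cycV : {vspace L} :=
  <<[seq lpow mul a i | i <- index_iota 2 (\dim {:L}).+1]>>%VS.

(* Left multiplication by [a] preserves [cycV] when [L] is a left Leibniz
   algebra generated by [a], so that the projection [vsproj] onto [cycV] only
   changes the type here. *)
Definition theta : 'End(subvs_of cycV) :=
  linfun (vsproj cycV \o mul a \o vsval).

(* The division is exact: 'X divides g - g(0). *)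
Definition hpoly (g : {poly F}) : {poly F} :=
  (g - (g.[0])%:P) %/ (g.[0] *: 'X).

(* As a^2 lies in [cycV], [vsproj] again only changes the type (if \dim L = 1,
   both are zero). *)
Definition cycb (g : {poly F}) : L :=
  a + vsval (lfun_horner (hpoly g) theta (vsproj cycV (lpow mul a 2))).

Variables (k : nat) (p : 'I_k -> {poly F}).

Definition cycVs (s : 'I_k -> nat) : {vspace L} :=
  (linfun vsval @:
     lker (\big[@comp_lfun _ _ _ _ / \1%VF]_(i < k)
             lfun_exp (lfun_horner (p i) theta) (s i)))%VS.

Definition cycU (B : {vspace L}) (s : 'I_k -> nat) : {vspace L} :=
  (B + cycVs s)%VS.

End Cyclic.

(* Main.v *)
Require Import Defs.
From HB Require Import structures.
From mathcomp Require Import all_boot all_order all_algebra.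

(** Write [a2] for the square of the generator [a] and, for a polynomial [q],
let [q] act on [L] as [q] of the left multiplication by [a].

The Leibniz identity makes every power of [a] of exponent at least 2
annihilate [L] from the left.  Hence [V] has trivial left action on [L], it is
stable under [a] and it is a hyperplane complementing the line of [a]
([cycV_annihilates], [cycV_mul], [cycV_full], [cycV_generator]).  As a module
over F[x] it is cyclic, generated by [a2], and the annihilator of [a2] is the
ideal of the characteristic polynomial f = x^r g of theta, since f kills [V] by
Cayley-Hamilton and has degree dim V ([horner_square_eq0]).  So [V] is
F[x]/(f), its stable subspaces correspond to the divisors of f, and each of
them is both the image of a divisor and the kernel ([torsion]) of the
complementary one ([torsion_limg], [invariant_subspace_limg]).

The polynomial h solves x h = g/g(0) - 1, which is exactly what turns the
product of [a] with b = a + h a2 into g a2 / g(0), a generator of the kernel of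
x^r.  Therefore B = <b> + ker x^r, and since the other kernels are those of
divisors of g, which is prime to x, U_s = <b> + ker (x^r prod p_i^s_i)
([generated_cycb], [cycU_line_torsion]).

Let [D] be a subalgebra containing some a + u a2.  Left multiplication by that
element is left multiplication by [a] on [L], so D cap V is a stable subspace,
the image of some divisor d of f.  It contains the square of a + u a2, which is
(1 + x u) a2; hence d divides 1 + x u, d is prime to x and divides g.  Modulo d
both x h and x u are -1, so h = u modulo d, so b lies in [D] and
D = <b> + ker (x^r g/d) ([subalgebra_line_torsion]).  Unique factorisation of
g/d gives the exponents.

Since [b] is not in [V], inclusion of the U_s is inclusion of their kernels,
that is divisibility, that is the componentwise order of the exponents
([cycUS]).  Classification and order determine meets and joins, which gives
the product of chains ([cycU_interval_iso]). *)

Set Implicit Arguments.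
Unset Strict Implicit.
Unset Printing Implicit Defensive.

Import GRing.Theory passmx.
Local Open Scope ring_scope.

(** * Polynomials in an endomorphism *)

Lemma lfun_expE (F : fieldType) (U : vectType F) (T : 'End(U)) n u :
  lfun_exp T n u = iter n T u.
Proof. by elim: n => [|n IHn]; rewrite /= ?lfunE //= IHn. Qed.

Section LfunHorner.
Variables (F : fieldType) (U : vectType F) (T : 'End(U)).
Implicit Types (p q : {poly F}) (u : U).

(** Summing up to any bound, rather than to the size of the polynomial, makes the
sums for different polynomials comparable term by term. *)
Lemma lfun_horner_widen n p u : (size p <= n)%N ->
  lfun_horner p T u = \sum_(i < n) p`_i *: iter i T u.
Proof.
move=> le_pn; rewrite sum_lfunE.
rewrite (big_ord_widen n (fun i => (p`_i *: lfun_exp T i) u) le_pn) big_mkcond.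
apply: eq_bigr => i _; rewrite lfunE /= lfun_expE.
by case: ltnP => // /(nth_default 0)->; rewrite scale0r.
Qed.
Arguments lfun_horner_widen n [p u] _.

Lemma lfun_horner0 u : lfun_horner 0 T u = 0.
Proof. by rewrite (lfun_horner_widen 0) ?size_poly0 // big_ord0. Qed.

Lemma lfun_hornerD p q u :
  lfun_horner (p + q) T u = lfun_horner p T u + lfun_horner q T u.
Proof.
pose m := maxn (size p) (size q).
rewrite !(lfun_horner_widen m) ?size_polyD ?leq_maxl ?leq_maxr // -big_split /=.
by apply: eq_bigr => i _; rewrite coefD scalerDl.
Qed.

Lemma lfun_hornerZ c p u : lfun_horner (c *: p) T u = c *: lfun_horner p T u.
Proof.
rewrite !(lfun_horner_widen (size p)) ?size_scale_leq // scaler_sumr.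
by apply: eq_bigr => i _; rewrite coefZ scalerA.
Qed.

Lemma lfun_hornerXn n u : lfun_horner 'X^n T u = iter n T u.
Proof.
rewrite (lfun_horner_widen n.+1) ?size_polyXn // big_ord_recr /= coefXn eqxx.
rewrite scale1r big1 ?add0r // => i _.
by rewrite coefXn ltn_eqF ?scale0r.
Qed.

Lemma lfun_hornerX u : lfun_horner 'X T u = T u.
Proof. exact: (lfun_hornerXn 1). Qed.

Lemma lfun_hornerC c u : lfun_horner c%:P T u = c *: u.
Proof. by rewrite -[c%:P]mulr1 mul_polyC lfun_hornerZ -(expr0 'X) lfun_hornerXn. Qed.

Lemma lfun_hornerM p q u :
  lfun_horner (p * q) T u = lfun_horner p T (lfun_horner q T u).
Proof.
have mulX r v : lfun_horner (r * 'X) T v = T (lfun_horner r T v).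
  rewrite (lfun_horner_widen (size r).+1); last first.
    by rewrite (leq_trans (size_polyMleq _ _)) // size_polyX addn2.
  rewrite big_ord_recl coefMX scale0r add0r (lfun_horner_widen (size r)) //.
  by rewrite linear_sum; apply: eq_bigr => i _; rewrite coefMX linearZ.
elim/poly_ind: p => [|p c IHp]; first by rewrite mul0r !lfun_horner0.
rewrite mulrDl -mulrA (mulrC 'X) mulrA !lfun_hornerD !mulX IHp.
by rewrite mul_polyC lfun_hornerZ lfun_hornerC.
Qed.

Lemma lfun_horner_exp p n u :
  lfun_horner (p ^+ n) T u = iter n (lfun_horner p T) u.
Proof.
elim: n => [|n IHn]; first by rewrite expr0 lfun_hornerC scale1r.
by rewrite exprS lfun_hornerM IHn.
Qed.

Lemma lfun_horner_stable (X : {vspace U}) q u :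
  (forall v, v \in X -> T v \in X) -> u \in X -> lfun_horner q T u \in X.
Proof.
move=> TX Xu; rewrite (lfun_horner_widen (size q)) // memv_suml // => i _.
by rewrite memvZ //; elim: (nat_of_ord i) => //= j; apply: TX.
Qed.

Lemma lfun_horner_prod k (p : 'I_k -> {poly F}) (e : 'I_k -> nat) u :
  (\big[@comp_lfun _ _ _ _ / \1%VF]_(i < k)
      lfun_exp (lfun_horner (p i) T) (e i)) u
    = lfun_horner (\prod_(i < k) p i ^+ e i) T u.
Proof.
move: u; apply: (big_ind2 (fun (A : 'End(U)) q =>
  forall u, A u = lfun_horner q T u)) => [u|A p1 B q IHp IHq u|i _ u].
- by rewrite lfunE lfun_hornerC scale1r.
- by rewrite lfunE /= IHq IHp lfun_hornerM.
- by rewrite lfun_expE lfun_horner_exp.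
Qed.

End LfunHorner.
Arguments lfun_horner_widen [F U] T n [p u] _.

Lemma lfun_horner_intertwine (F : fieldType) (U W : vectType F)
    (T : 'End(U)) (S : 'End(W)) (phi : {linear U -> W}) :
    (forall u, phi (T u) = S (phi u)) ->
  forall p u, phi (lfun_horner p T u) = lfun_horner p S (phi u).
Proof.
move=> phiT p u; rewrite !(lfun_horner_widen _ (size p)) // linear_sum.
apply: eq_bigr => i _; rewrite linearZ; congr (_ *: _).
by elim: (nat_of_ord i) => //= j IHj; rewrite phiT IHj.
Qed.

(** In terms of iterated actions on a row, Cayley-Hamilton also makes sense in size
0, where the matrices form the zero ring; [V] is zero when dim L = 1. *)
Lemma row_Cayley_Hamilton (F : fieldType) m (M : 'M[F]_m) (w : 'rV_m) :
  \sum_(i < m.+1) (char_poly M)`_i *: iter i (mulmxr M) w = 0.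
Proof.
case: m M w => [|m] M w; first by rewrite [LHS]thinmx0.
have iterE i : iter i (mulmxr M) w = w *m M ^+ i.
  elim: i => [|i IHi]; first by rewrite expr0 mulmx1.
  by rewrite iterS IHi exprSr mulmxA.
transitivity (w *m horner_mx M (char_poly M)); last first.
  by rewrite Cayley_Hamilton mulmx0.
rewrite -[in RHS](coefK (char_poly M)) poly_def raddf_sum mulmx_sumr.
rewrite size_char_poly; apply: eq_bigr => i _ /=.
by rewrite linearZ /= rmorphXn /= horner_mx_X -scalemxAr iterE.
Qed.

Lemma lfun_Cayley_Hamilton (F : fieldType) (U : vectType F) (T : 'End(U)) u :
  lfun_horner (lfun_char_poly T) T u = 0.
Proof.
have bU := vbasisP {:U}.
apply/eqP; rewrite -(rVof_eq0 bU); apply/eqP.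
rewrite (lfun_horner_widen T (\dim {:U}).+1) ?size_char_poly // linear_sum /=.
rewrite -[RHS](row_Cayley_Hamilton (mxof (vbasis {:U}) (vbasis {:U}) T)
  (rVof (vbasis {:U}) u)).
apply: eq_bigr => i _; rewrite linearZ /=; congr (_ *: _).
by elim: (nat_of_ord i) => //= j <-; rewrite -rVof_app.
Qed.

Lemma lfun_char_poly_neq0 (F : fieldType) (U : vectType F) (T : 'End(U)) :
  lfun_char_poly T != 0.
Proof. exact: monic_neq0 (char_poly_monic _). Qed.

(** * Divisors of a product of powers of irreducible polynomials *)

Section IrreducibleProducts.
Variables (F : fieldType) (k : nat) (p : 'I_k -> {poly F}).
Hypothesis hp : forall i, irreducible_poly (p i).
Implicit Types (d : {poly F}) (e : 'I_k -> nat).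

Lemma prod_irreducible_neq0 e : \prod_(i < k) p i ^+ e i != 0.
Proof. by apply/prodf_neq0 => i _; rewrite expf_neq0 // irredp_neq0. Qed.

Lemma prod_exp_split e e' : (forall i, (e i <= e' i)%N) ->
  \prod_(i < k) p i ^+ e' i
    = (\prod_(i < k) p i ^+ e i) * \prod_(i < k) p i ^+ (e' i - e i).
Proof.
by move=> lee; rewrite -big_split; apply: eq_bigr => i _ /=; rewrite -exprD subnKC.
Qed.

Lemma dvdp_prod_exp e e' : (forall i, (e i <= e' i)%N) ->
  \prod_(i < k) p i ^+ e i %| \prod_(i < k) p i ^+ e' i.
Proof. by move=> lee; rewrite (prod_exp_split lee) dvdp_mulr. Qed.

(** By induction on the total exponent: a divisor prime to every factor is a unit,
and otherwise some [p i] with [0 < e i] divides it and can be cancelled on both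
sides. *)
Lemma dvdp_prod_irreducible d e : d %| \prod_(i < k) p i ^+ e i ->
  exists2 e', forall i, (e' i <= e i)%N & d %= \prod_(i < k) p i ^+ e' i.
Proof.
have [m] := ubnP (\sum_i e i)%N; elim: m d e => // m IHm d e lt_em dv_d.
have [/forallP-cop | /forallPn[i]] :=
  boolP [forall i, coprimep d (p i ^+ e i)].
  exists (fun=> 0%N) => //.
  rewrite big1 => [|i _]; last exact: expr0.
  have cop_d : coprimep d (\prod_(i < k) p i ^+ e i).
    by elim/big_rec: _ => [|i q _ cq]; rewrite ?coprimep1 // coprimepMr cop.
  by rewrite -size_poly_eq1 -dvdp1 -(Gauss_dvdpr 1 cop_d) mulr1.
have [-> | ei_gt0] := posnP (e i); first by rewrite expr0 coprimep1.
rewrite coprimep_pexpr // coprimep_sym irreducible_poly_coprime // negbK => dv_pd.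
pose e1 j := (e j - (j == i))%N.
have le_e1 j : (e1 j <= e j)%N by rewrite leq_subr.
have e1_split : \prod_(i < k) p i ^+ e i = p i * \prod_(i < k) p i ^+ e1 i.
  rewrite (prod_exp_split le_e1) mulrC; congr (_ * _).
  rewrite (bigD1 i) //= /e1 eqxx subKn // expr1 big1 ?mulr1 // => j /negPf->.
  by rewrite subn0 subnn.
have [q def_d] := dvdpP _ _ dv_pd.
have [||e2 le_e2 eq_q] := IHm q e1.
- rewrite -ltnS (leq_trans _ lt_em) // ltnS (bigD1 i) //=.
  rewrite [X in (_ < X)%N](bigD1 i) //=.
  rewrite /e1 eqxx subn1 -addSn prednK // leq_add2l leq_sum // => j _.
  exact: leq_subr.
- by move: dv_d; rewrite def_d e1_split mulrC dvdp_mul2l ?irredp_neq0.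
exists (fun j => (e2 j + (j == i))%N) => [j|].
  have := le_e2 j; rewrite /e1; case: eqP => [->|_]; last by rewrite subn0 addn0.
  by move=> le_e2i; rewrite -(subnK ei_gt0) leq_add2r.
rewrite def_d mulrC (eqp_trans (eqp_mull _ eq_q)) //.
suff -> : \prod_j p j ^+ (e2 j + (j == i)) = p i * \prod_j p j ^+ e2 j.
  exact: eqpxx.
under eq_bigr do rewrite exprD; rewrite big_split mulrC; congr (_ * _).
by rewrite (bigD1 i) //= eqxx expr1 big1 ?mulr1 // => j /negPf->.
Qed.

(** [p i] is prime to the powers of the other factors, so its power on the left
divides its power on the right. *)
Lemma dvdp_prod_irreducible_le e e' :
    (forall i j, i != j -> ~~ (p i %= p j)) ->
    \prod_(i < k) p i ^+ e i %| \prod_(i < k) p i ^+ e' i ->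
  forall i, (e i <= e' i)%N.
Proof.
move=> hdist dv i; have [gt1 _] := hp i.
rewrite -(dvdp_Pexp2l _ _ gt1); move: dv.
rewrite [X in _ %| X](bigD1 i) //= (bigD1 i) //=.
move=> /(dvdp_trans (dvdp_mulr _ (dvdpp _))).
rewrite Gauss_dvdpl //; elim/big_rec: _ => [|j q ne_ji cq]; first exact: coprimep1.
rewrite coprimepMr cq andbT coprimep_expl // coprimep_expr //.
rewrite irreducible_poly_coprime //; apply: contra (hdist _ _ ne_ji) => dv_ij.
have [_ irr_j] := hp j; rewrite eqp_sym irr_j //.
by rewrite neq_ltn gt1 orbT.
Qed.

End IrreducibleProducts.

(** * Left Leibniz algebras with one generator *)

Section LeftLeibniz.
Variables (F : fieldType) (L : vectType F) (mul : {bilinear L -> L -> L}).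
Hypothesis hL : left_leibniz mul.

Lemma leibniz_square_annihilates x z : mul (mul x x) z = 0.
Proof. by apply: (addIr (mul x (mul x z))); rewrite -hL add0r. Qed.

(** Left multiplication by a product is the commutator of the left multiplications,
so the annihilation passes from one power to the next. *)
Lemma lpow_annihilates x i z : mul (lpow mul x i.+2) z = 0.
Proof.
elim: i z => [|i IHi] z; first exact: leibniz_square_annihilates.
apply: (addIr (mul (lpow mul x i.+2) (mul x z))).
by rewrite -[lpow mul x i.+3]/(mul x _) -hL !IHi linear0 addr0.
Qed.

End LeftLeibniz.

Section CyclicLeibniz.
Variables (F : fieldType) (L : vectType F) (mul : {bilinear L -> L -> L}).
Hypothesis hL : left_leibniz mul.
Variable a : L.
Hypothesis ha : generated mul <[a]>%VS fullv.
Hypothesis hn : (1 <= \dim {:L})%N.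

Local Notation V := (cycV mul a).
Local Notation n := (\dim {:L}).
Local Notation S := (linfun (mul a)).
Local Notation a2 := (lpow mul a 2).
Local Notation act q := (lfun_horner q S).
Local Notation f := (lfun_char_poly (theta mul a)).

Lemma linfun_mulE x : S x = mul a x.
Proof. by rewrite lfunE. Qed.

Lemma iter_linfun_mul i : iter i S a = lpow mul a i.+1.
Proof. by elim: i => //= i ->; rewrite linfun_mulE. Qed.

Lemma cycV_ind (P : L -> Prop) :
    P 0 -> (forall c x y, P x -> P y -> P (c *: x + y)) ->
    (forall i, (i.+1 < n)%N -> P (lpow mul a i.+2)) -> forall v, v \in V -> P v.
Proof.
move=> P0 Plin Ppow v Vv; rewrite (coord_span (X := in_tuple _) Vv).
elim/big_rec: _ => // i x _; apply: Plin.
set s := tval _; have /mapP[j] : s`_i \in s by rewrite mem_nth.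
by rewrite mem_index_iota => /andP[]; case: j => [|[|j]] // _ ltjn ->; apply: Ppow.
Qed.

Lemma cycV_annihilates v z : v \in V -> mul v z = 0.
Proof.
move: v; apply: cycV_ind => [|c x y mx my|i _]; first by rewrite linear0l.
  by rewrite linearPl mx my scaler0 addr0.
exact: lpow_annihilates.
Qed.

Lemma cycV_lpow_low i : (i.+1 < n)%N -> lpow mul a i.+2 \in V.
Proof. by move=> lt_in; apply/memv_span/map_f; rewrite mem_index_iota. Qed.

(** Cayley-Hamilton on [L] writes this power as a combination of [a] and of the
powers spanning [V].  If [a] occurs in it, then [a] annihilates [L] from the left
like all the other terms, so the product of [a] with itself vanishes and so do
all higher powers. *)
Lemma lpow_dim_cycV : lpow mul a n.+1 \in V.
Proof.
have [m def_n] : {m | n = m.+1} by exists n.-1; rewrite prednK.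
pose P := lfun_char_poly S; have szP : size P = m.+2.
  by rewrite size_char_poly def_n.
have Pn : P`_m.+1 = 1.
  have /monicP := char_poly_monic (mxof (vbasis {:L}) (vbasis {:L}) S).
  by rewrite lead_coefE -/P szP.
have := lfun_Cayley_Hamilton S a; rewrite def_n.
rewrite (lfun_horner_widen _ m.+2) ?szP // big_ord_recr /= -/P Pn scale1r.
rewrite linfun_mulE iter_linfun_mul big_ord_recl /=.
set w := \sum_(i < _) _; have Vw : w \in V.
  apply: memv_suml => i _; rewrite linfun_mulE iter_linfun_mul memvZ //.
  by apply: cycV_lpow_low; rewrite def_n ltnS ltn_ord.
rewrite -[mul a _]/(lpow mul a m.+2) => /(canRL (addKr _)); rewrite addr0 => def_an.
have [P0 | nzP0] := eqVneq P`_0 0.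
  by rewrite def_an P0 scale0r add0r rpredN.
have /eqP : mul (lpow mul a m.+2) a = 0 by rewrite lpow_annihilates.
rewrite def_an linearNl linearDl linearZl_LR /=.
rewrite -def_an (cycV_annihilates _ Vw) addr0 oppr_eq0 scaler_eq0 (negPf nzP0) /=.
move=> /eqP a2_0; suff ->: lpow mul a m.+2 = 0 by rewrite mem0v.
by elim: (m) => //= i IHi; rewrite [LHS](congr1 (mul a) IHi) linear0.
Qed.

Lemma cycV_mul v : v \in V -> mul a v \in V.
Proof.
move: v; apply: cycV_ind => [|c x y Vx Vy|i lt_in].
- by rewrite linear0 mem0v.
- by rewrite linearP memvD ?memvZ.
have [lt_i1n | ] := ltnP i.+2 n; first exact: (@cycV_lpow_low i.+1).
move=> le_ni; have eq_n : n = i.+2 by apply/eqP; rewrite eqn_leq le_ni lt_in.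
by have := lpow_dim_cycV; rewrite eq_n.
Qed.

Lemma cycV_lpow i : lpow mul a i.+2 \in V.
Proof.
elim: i => [|i IHi]; last exact: cycV_mul.
have [lt1n | len1] := ltnP 1 n; first exact: cycV_lpow_low.
by have := lpow_dim_cycV; rewrite (_ : n = 1%N) //; apply/eqP; rewrite eqn_leq len1.
Qed.

Lemma cycV_full : (<[a]> + V)%VS = fullv.
Proof.
apply/eqP; rewrite eqEsubv subvf /=; have [_ _ minL] := ha; apply: minL.
  move=> x y /memv_addP[_ /vlineP[c ->] [v Vv ->]].
  move=> /memv_addP[_ /vlineP[d ->] [w Vw ->]].
  rewrite linearDl (cycV_annihilates _ Vv) addr0 linearZl_LR linearDr linearZr_LR.
  apply: subvP (addvSr _ _) _ _; rewrite memvZ // memvD ?cycV_mul //.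
  by rewrite memvZ // (cycV_lpow 0).
exact: addvSl.
Qed.

(** [V] is spanned by n - 1 vectors and is complemented by a line. *)
Lemma cycV_dim : (\dim V).+1 = n.
Proof.
apply/eqP; rewrite eqn_leq; apply/andP; split.
  rewrite -[n]prednK // ltnS (leq_trans (dim_span _)) //.
  by rewrite size_map size_iota subSS subn1.
rewrite -cycV_full (leq_trans (dimv_add_leqif _ _)) //.
by rewrite dim_vline; case: (a != 0).
Qed.

Lemma cycV_generator : a \notin V.
Proof.
apply/negP=> Va; have := cycV_dim; rewrite -cycV_full.
by have /addv_idPr-> : (<[a]> <= V)%VS by []; move/eqP; rewrite gtn_eqF.
Qed.

Lemma horner_lpow i : act 'X^i a2 = lpow mul a i.+2.
Proof. by rewrite lfun_hornerXn; elim: i => //= i ->; rewrite linfun_mulE. Qed.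

Lemma cycV_horner q v : v \in V -> act q v \in V.
Proof.
by apply: lfun_horner_stable => u Vu; rewrite linfun_mulE cycV_mul.
Qed.

Lemma vsval_horner_theta q u :
  vsval (lfun_horner q (theta mul a) u) = act q (vsval u).
Proof.
apply: lfun_horner_intertwine => {}u.
by rewrite linfun_mulE lfunE /= vsprojK // cycV_mul // subvsP.
Qed.

Lemma cycV_cyclic v : v \in V -> exists q, v = act q a2.
Proof.
move: v; apply: cycV_ind => [|c x y [q ->] [q' ->]|i _].
- by exists 0; rewrite lfun_horner0.
- by exists (c *: q + q'); rewrite lfun_hornerD lfun_hornerZ.
- by exists 'X^i; rewrite horner_lpow.
Qed.

Lemma cycV_char_poly v : v \in V -> act f v = 0.
Proof.
move=> Vv; rewrite -(vsprojK Vv) -vsval_horner_theta lfun_Cayley_Hamilton.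
exact: linear0.
Qed.

(** The remainder modulo f has degree less than dim V, so its value at [a2] is a
combination of the powers that form a basis of [V]. *)
Lemma horner_square_eq0 q : (act q a2 == 0) = (f %| q).
Proof.
have Va2 := cycV_lpow 0.
have sz_f : size f = n by rewrite size_char_poly dimvf -cycV_dim.
apply/idP/idP => [/eqP q0 | /dvdpP[q' ->]]; last first.
  by rewrite lfun_hornerM cycV_char_poly // linear0.
have nz_f : f != 0 := lfun_char_poly_neq0 _.
have {q0} : act (q %% f) a2 = 0.
  move: q0; rewrite {1}(divp_eq q f) lfun_hornerD lfun_hornerM cycV_char_poly //.
  by rewrite linear0 add0r.
have lt_qf : (size (q %% f)%R <= n.-1)%N by rewrite -ltnS prednK // -sz_f ltn_modp.
rewrite /dvdp; move: (q %% f) lt_qf => {}q le_q.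
pose X := [seq lpow mul a i | i <- index_iota 2 n.+1].
have szX : size X = n.-1 by rewrite size_map size_iota subSS subn1.
have freeX : free X.
  by rewrite /free szX -[<<X>>%VS]/V -cycV_dim.
rewrite -szX in le_q; rewrite (lfun_horner_widen S _ le_q) => q0.
have {}q0 : \sum_(i < size X) q`_i *: X`_i = 0.
  rewrite -[RHS]q0; apply: eq_bigr => i _; congr (_ *: _).
  rewrite (nth_map 0%N) ?nth_iota; last 2 first.
  - by rewrite subSS subn1 -szX.
  - by rewrite size_iota subSS subn1 -szX.
  by rewrite -lfun_hornerXn horner_lpow.
have q_i0 := @freeP _ _ _ (in_tuple X) freeX _ q0.
apply/eqP/polyP => i; rewrite coef0.
have [lt_iX | le_Xi] := ltnP i (size X); first exact: (q_i0 (Ordinal lt_iX)).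
by rewrite nth_default // (leq_trans le_q).
Qed.

(** * The F[x]-module V *)

Definition torsion q : {vspace L} := (V :&: lker (act q))%VS.

Lemma mem_torsion q v : (v \in torsion q) = (v \in V) && (act q v == 0).
Proof. by rewrite memv_cap memv_ker. Qed.

Lemma torsion_sub_cycV q : (torsion q <= V)%VS.
Proof. exact: capvSl. Qed.

Lemma torsion_mul q v : v \in torsion q -> mul a v \in torsion q.
Proof.
rewrite !mem_torsion => /andP[Vv /eqP qv0]; rewrite cycV_mul //=.
rewrite -linfun_mulE -(lfun_hornerX S) -lfun_hornerM mulrC.
by rewrite lfun_hornerM qv0 linear0 eqxx.
Qed.

Lemma torsionS q q' : q %| q' -> (torsion q <= torsion q')%VS.
Proof.
case/dvdpP=> m ->; apply/subvP=> v; rewrite !mem_torsion => /andP[-> /eqP qv0].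
by rewrite lfun_hornerM qv0 linear0 eqxx.
Qed.

Lemma torsion_eqp q q' : q %= q' -> torsion q = torsion q'.
Proof. by case/andP=> qq' q'q; apply: subv_anti; rewrite !torsionS. Qed.

(** A Bezout relation splits a vector into a part killed by [q] and a part killed
by [q']. *)
Lemma torsionM_coprime q q' : coprimep q q' ->
  torsion (q * q') = (torsion q + torsion q')%VS.
Proof.
move=> cop; apply: subv_anti; rewrite subv_add !torsionS ?dvdp_mulIl ?dvdp_mulIr //.
rewrite ?andbT; have [[m m'] /= /eqpf_eq[c nz_c bez]] := Bezout_coprimepP _ _ cop.
apply/subvP=> v; rewrite mem_torsion => /andP[Vv /eqP qv0].
have -> : v = c^-1 *: (act (m' * q') v + act (m * q) v).
  rewrite -lfun_hornerD addrC bez -mul_polyC mulr1 lfun_hornerC scalerA mulVf //.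
  by rewrite scale1r.
rewrite memvZ // memv_add // mem_torsion cycV_horner // -lfun_hornerM.
  by rewrite mulrCA lfun_hornerM qv0 linear0 eqxx.
by rewrite mulrC -mulrA lfun_hornerM qv0 linear0 eqxx.
Qed.

(** In F[x]/(q q'), the product of q with u vanishes exactly when q' divides u. *)
Lemma torsion_limg q q' : f = q * q' -> torsion q = (act q' @: V)%VS.
Proof.
move=> def_f; have nz_q : q != 0.
  by have := lfun_char_poly_neq0 (theta mul a); rewrite def_f mulf_eq0 => /norP[].
apply/vspaceP => v; rewrite mem_torsion.
apply/andP/memv_imgP => [[Vv qv0] | [w Vw ->]]; last first.
  by rewrite cycV_horner // -lfun_hornerM -def_f cycV_char_poly.
have [u def_v] := cycV_cyclic Vv.
move: qv0; rewrite def_v -lfun_hornerM horner_square_eq0 def_f dvdp_mul2l //.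
case/dvdpP=> u' ->; exists (act u' a2); first exact: cycV_horner (cycV_lpow 0).
by rewrite mulrC lfun_hornerM.
Qed.

(** If f = m q then [act m a2] is killed by [q] and its annihilator is exactly the
ideal of [q]. *)
Lemma torsion_sub_dvdp q q' : q %| f -> (torsion q <= torsion q')%VS -> q %| q'.
Proof.
case/dvdpP=> m def_f /subvP/(_ (act m a2)); rewrite !mem_torsion.
have nz_m : m != 0.
  by have := lfun_char_poly_neq0 (theta mul a); rewrite def_f mulf_eq0 => /norP[].
rewrite cycV_horner ?(cycV_lpow 0) // -!lfun_hornerM !horner_square_eq0 /=.
by rewrite def_f mulrC dvdpp dvdp_mul2r //; apply.
Qed.

(** The polynomials q with [act q a2] in [X] form an ideal, and [d] is its generator.
It is found by descent from f: as long as the image of [d] misses some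
[act q a2] in [X], [d] can be replaced with the strictly smaller gcd of [d] and
[q].  Inclusion of subspaces being decidable, this is constructive. *)
Lemma invariant_subspace_limg (X : {vspace L}) :
    (X <= V)%VS -> (forall v, v \in X -> mul a v \in X) ->
  exists2 d, d %| f & X = (act d @: V)%VS.
Proof.
move=> XV aX; have actX q v : v \in X -> act q v \in X.
  by apply: lfun_horner_stable => u Xu; rewrite linfun_mulE aX.
have Va2 := cycV_lpow 0.
suff /(_ _ f): forall m (d : {poly F}), (size d < m)%N -> d %| f -> act d a2 \in X ->
    exists2 d, d %| f & X = (act d @: V)%VS.
  by move/(_ _ (ltnSn _) (dvdpp _)); apply; rewrite cycV_char_poly // mem0v.
elim=> // m IHm d lt_dm dv_df Xd.
have [leX | /subvPn[x Xx]] := boolP (X <= act d @: V)%VS.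
  exists d => //; apply: subv_anti; rewrite leX; apply/subvP => _ /memv_imgP[v Vv ->].
  have [q ->] := cycV_cyclic Vv.
  by rewrite -lfun_hornerM mulrC lfun_hornerM actX.
have [q def_x] := cycV_cyclic (subvP XV _ Xx); rewrite def_x => ndv.
have [[u v] /= bez] := Bezoutp d q; apply: (IHm (gcdp d q)).
- rewrite -ltnS (leq_trans _ lt_dm) // ltnS ltn_neqAle; apply/andP; split; last first.
    rewrite dvdp_leq ?dvdp_gcdl //; apply: contraTneq dv_df => ->.
    by rewrite dvd0p lfun_char_poly_neq0.
  apply: contra ndv; rewrite dvdp_size_eqp ?dvdp_gcdl // => eq_gd.
  have /dvdpP[w ->] : d %| q by rewrite -(eqp_dvdl _ eq_gd) dvdp_gcdr.
  by rewrite mulrC lfun_hornerM memv_img // cycV_horner.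
- exact: dvdp_trans (dvdp_gcdl _ _) dv_df.
have /dvdpP[w ->] : u * d + v * q %| gcdp d q by case/andP: bez.
rewrite lfun_hornerM lfun_hornerD !lfun_hornerM -def_x.
by rewrite actX // memvD // actX.
Qed.

Lemma cycVs_torsion k (p : 'I_k -> {poly F}) (s : 'I_k -> nat) :
  cycVs mul a p s = torsion (\prod_(i < k) p i ^+ s i).
Proof.
apply/vspaceP => v; rewrite mem_torsion; apply/memv_imgP/andP => [[u] | [Vv pv0]].
  rewrite memv_ker lfun_horner_prod lfunE /= => /eqP pu0 ->.
  by rewrite subvsP -vsval_horner_theta pu0 linear0.
exists (vsproj V v); last by rewrite lfunE /= vsprojK.
rewrite memv_ker lfun_horner_prod -(inj_eq subvs_inj) vsval_horner_theta.
by rewrite vsprojK // linear0.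
Qed.

(** * The element b and the subalgebras not contained in V *)

Section SubalgebraU.
Variables (r : nat) (g : {poly F}).
Hypotheses (hf : f = 'X^r * g) (hg0 : g.[0] != 0).
Local Notation b := (cycb mul a g).

Lemma hpolyE : 'X * hpoly g = g.[0]^-1 *: g - 1.
Proof.
have dvX : g.[0] *: 'X %| g - g.[0]%:P.
  by rewrite dvdpZl // -['X]subr0 -polyC0 dvdp_XsubCl rootE !hornerE subrr.
have := divpK dvX; rewrite -/(hpoly g) -scalerAr => /(canRL (scalerK hg0)).
rewrite mulrC => ->; rewrite scalerBr; congr (_ - _).
by rewrite -mul_polyC -polyCM mulVf.
Qed.

Lemma cycbE : b = a + act (hpoly g) a2.
Proof. by rewrite /cycb vsval_horner_theta vsprojK ?(cycV_lpow 0). Qed.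

Lemma cycb_sub_cycV : b - a \in V.
Proof. by rewrite cycbE addrC addKr cycV_horner ?(cycV_lpow 0). Qed.

Lemma cycb_notin_cycV : b \notin V.
Proof.
apply: contra cycV_generator => Vb.
by have := rpredB Vb cycb_sub_cycV; rewrite subKr.
Qed.

Lemma cycb_full : (<[b]> + V)%VS = fullv.
Proof.
apply/eqP; rewrite eqEsubv subvf -cycV_full subv_add addvSr andbT -memvE.
have Bb : b \in (<[b]> + V)%VS := subvP (addvSl _ _) _ (memv_line b).
by have := rpredB Bb (subvP (addvSr _ _) _ cycb_sub_cycV); rewrite subKr.
Qed.

(** The term g(0) removed from g by the definition of h is what cancels [a2]. *)
Lemma mul_generator_cycb : mul a b = g.[0]^-1 *: act g a2.
Proof.
rewrite cycbE linearDr -(linfun_mulE (act (hpoly g) a2)) -(lfun_hornerX S) -lfun_hornerM.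
rewrite hpolyE lfun_hornerD lfun_hornerZ -[- 1]scaleN1r lfun_hornerZ lfun_hornerC.
by rewrite scaleN1r scale1r [LHS]addrC subrK.
Qed.

Lemma cycb_mull x : mul b x = mul a x.
Proof.
by rewrite -(subrK a b) linearDl (cycV_annihilates _ cycb_sub_cycV) add0r.
Qed.

Lemma mul_line_cycV (c d : F) v w : v \in V -> w \in V ->
  mul (c *: b + v) (d *: b + w) = c *: (d *: mul a b + mul a w).
Proof.
move=> Vv Vw; rewrite linearDl (cycV_annihilates _ Vv) addr0 linearZl_LR /=.
by rewrite cycb_mull linearD linearZ.
Qed.

(** Products land in [V]: up to scalars they are the sum of a product of [a] with
an element of the kernel and of [act g a2], which is killed by x^r because
x^r g = f. *)
Lemma line_torsion_subalgebra q : 'X^r %| q -> subalgebra mul (<[b]> + torsion q)%VS.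
Proof.
case/dvdpP=> m def_q x y /memv_addP[_ /vlineP[c ->] [v Tv ->]].
move=> /memv_addP[_ /vlineP[d ->] [w Tw ->]]; have /subvP TV := torsion_sub_cycV q.
rewrite mul_line_cycV ?TV // (subvP (addvSr _ _)) // memvZ // memvD ?torsion_mul //.
rewrite memvZ // mul_generator_cycb memvZ // mem_torsion cycV_horner ?(cycV_lpow 0) //=.
by rewrite -lfun_hornerM def_q -mulrA -hf horner_square_eq0 dvdp_mull.
Qed.

(** The kernel of x^r is the image of g, so it is spanned by what left
multiplication by [b] yields from the square of [b]. *)
Lemma generated_cycb B : generated mul <[b]>%VS B -> B = (<[b]> + torsion 'X^r)%VS.
Proof.
case=> sB bB minB; apply: subv_anti; rewrite minB ?addvSl //; last first.
  by apply: line_torsion_subalgebra.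
rewrite subv_add bB (torsion_limg hf); apply/subvP => _ /memv_imgP[v Vv ->].
have [q ->] := cycV_cyclic Vv.
have Bb : b \in B by rewrite memvE.
have Bg : act g a2 \in B.
  suff -> : act g a2 = g.[0] *: mul b b by rewrite memvZ // sB.
  by rewrite cycb_mull mul_generator_cycb scalerA mulfV // scale1r.
rewrite -lfun_hornerM mulrC lfun_hornerM lfun_horner_stable // => u Bu.
by rewrite linfun_mulE -cycb_mull sB.
Qed.

Lemma line_torsionS q q' :
  (<[b]> + torsion q <= <[b]> + torsion q')%VS = (torsion q <= torsion q')%VS.
Proof.
apply/idP/idP => [le_qq' | le_qq']; last exact: addvS.
apply/subvP=> v Tv; have Vv := subvP (torsion_sub_cycV _) _ Tv.
have /memv_addP[_ /vlineP[c ->] [w Tw def_v]] := subvP le_qq' _ (subvP (addvSr _ _) _ Tv).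
have Vw := subvP (torsion_sub_cycV _) _ Tw.
have [c0 | nz_c] := eqVneq c 0; first by rewrite def_v c0 scale0r add0r.
case/negP: cycb_notin_cycV; rewrite -(scalerK nz_c b) memvZ //.
by rewrite -(addrK w (c *: b)) -def_v rpredB.
Qed.

(** [d] generates the ideal of the q with [act q a2] in [D].  It divides 1 + x u
for any a + u a2 in [D], which makes it prime to x and forces [b] into [D]. *)
Lemma subalgebra_line_torsion D : subalgebra mul D -> ~~ (D <= V)%VS ->
  exists2 d, d %| g & D = (<[b]> + torsion ('X^r * (g %/ d)))%VS.
Proof.
move=> sD /subvPn[x Dx nVx]; have Va2 := cycV_lpow 0.
have [v Vv Dav] : exists2 v, v \in V & a + v \in D.
  have := memvf x; rewrite -cycV_full => /memv_addP[_ /vlineP[c ->] [v Vv def_x]].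
  have [c0 | nz_c] := eqVneq c 0.
    by case/negP: nVx; rewrite def_x c0 scale0r add0r.
  exists (c^-1 *: v); first by rewrite memvZ.
  by rewrite -(scalerK nz_c a) -scalerDr -def_x memvZ.
have mul_av w : mul (a + v) w = mul a w by rewrite linearDl (cycV_annihilates _ Vv) addr0.
have [||d dv_df defX] := @invariant_subspace_limg (D :&: V)%VS.
- exact: capvSr.
- by move=> w /memv_capP[Dw Vw]; rewrite memv_cap cycV_mul // -mul_av sD.
have dvdX q : act q a2 \in (D :&: V)%VS = (d %| q).
  rewrite defX; apply/memv_imgP/idP => [[w Vw] | /dvdpP[m ->]]; last first.
    by exists (act m a2); rewrite ?cycV_horner // mulrC lfun_hornerM.
  have [m ->] := cycV_cyclic Vw; rewrite -lfun_hornerM => /eqP.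
  rewrite -subr_eq0 -scaleN1r -lfun_hornerZ -lfun_hornerD horner_square_eq0 scaleN1r.
  by move/(dvdp_trans dv_df); rewrite dvdp_subl ?dvdp_mulr.
have [u def_v] := cycV_cyclic Vv.
have dv_u : d %| 1 + 'X * u.
  rewrite -dvdX memv_cap lfun_hornerD lfun_hornerC scale1r lfun_hornerM -def_v.
  rewrite lfun_hornerX linfun_mulE (memvD Va2 (cycV_mul Vv)) andbT.
  by rewrite -[a2]/(mul a a) -linearDr -mul_av sD.
have cop_dX : coprimep d 'X.
  rewrite coprimepX; apply: contraTN dv_u => d0; apply/negP => /dvdpP[m].
  by move/(congr1 (horner^~ 0))/eqP; rewrite !hornerE (rootP d0) mulr0 oner_eq0.
have dv_dg : d %| g by rewrite -(Gauss_dvdpr _ (coprimep_expr r cop_dX)) -hf.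
have Db : b \in D.
  rewrite -(subrK (a + v) b) memvD // cycbE def_v opprD addrACA subrr add0r.
  rewrite -scaleN1r -lfun_hornerZ -lfun_hornerD scaleN1r.
  suff : d %| hpoly g - u by rewrite -dvdX => /memv_capP[].
  (* x (h - u) = g / g(0) - (1 + x u), and d is prime to x. *)
  rewrite -(Gauss_dvdpr _ cop_dX) mulrBr hpolyE -addrA -opprD dvdp_sub //.
  by rewrite dvdpZr // invr_eq0.
have def_D : D = (<[b]> + (D :&: V))%VS.
  apply: subv_anti; rewrite subv_add capvSl -memvE Db !andbT.
  apply/subvP => y Dy; have := memvf y; rewrite -cycb_full.
  case/memv_addP=> _ /vlineP[c ->] [w Vw def_y].
  rewrite def_y memv_add ?memvZ ?memv_line // memv_cap Vw andbT.
  by rewrite -(addKr (c *: b) w) -def_y memvD ?memvN ?memvZ.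
exists d => //; rewrite {1}def_D defX -(@torsion_limg ('X^r * (g %/ d))) //.
by rewrite hf -mulrA divpK.
Qed.

(** * The lattice of subalgebras above B *)

Section Interval.
Variables (B : {vspace L}) (k : nat) (p : 'I_k -> {poly F}) (rs : 'I_k -> nat).
Hypothesis hB : generated mul <[b]>%VS B.
Hypothesis hp : forall i, irreducible_poly (p i).
Hypothesis hdist : forall i j, i != j -> ~~ (p i %= p j).
Hypothesis hg : g = \prod_(i < k) p i ^+ rs i.
Implicit Types s t : 'I_k -> nat.
Local Notation U := (cycU mul a p B).
Local Notation prodp s := (\prod_(i < k) p i ^+ s i).

Lemma cycU_line_torsion s : (forall i, (s i <= rs i)%N) ->
  U s = (<[b]> + torsion ('X^r * prodp s))%VS.
Proof.
move=> le_s; rewrite torsionM_coprime; last first.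
  apply: coprimep_expl; apply: (coprimep_dvdl (dvdp_prod_exp p le_s)).
  by rewrite -hg coprimep_sym coprimepX.
by rewrite /cycU cycVs_torsion (generated_cycb hB) addvA.
Qed.

Lemma cycUS s t : (forall i, (s i <= rs i)%N) -> (forall i, (t i <= rs i)%N) ->
  (U s <= U t)%VS <-> (forall i, (s i <= t i)%N).
Proof.
move=> le_s le_t; rewrite !cycU_line_torsion // line_torsionS.
have nzXr : 'X^r != 0 :> {poly F} by rewrite monic_neq0 ?monicXn.
split=> [/torsion_sub_dvdp | le_st].
  rewrite hf dvdp_mul2l // {1}hg dvdp_prod_exp // dvdp_mul2l // => /(_ isT).
  exact: dvdp_prod_irreducible_le.
by rewrite torsionS // dvdp_mul2l // dvdp_prod_exp.
Qed.

Lemma subalgebra_notin_cycV D :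
  (subalgebra mul D /\ ~~ (D <= V)%VS) <->
  exists2 s, (forall i, (s i <= rs i)%N) & D = U s.
Proof.
split=> [[sD nDV] | [s le_s ->]]; last first.
  rewrite cycU_line_torsion //; split; first exact/line_torsion_subalgebra/dvdp_mulr.
  by apply: contra cycb_notin_cycV; rewrite subv_add -memvE => /andP[].
have [d dv_dg ->] := subalgebra_line_torsion sD nDV.
have := dv_dg; rewrite {1}hg => /(dvdp_prod_irreducible hp)[e le_e eq_d].
have le_re i : (rs i - e i <= rs i)%N by rewrite leq_subr.
(* D cap V is the image of prod p_i^e_i, that is the kernel of the cofactor. *)
exists (fun i => rs i - e i)%N => //; rewrite cycU_line_torsion //.
congr (_ + _)%VS; apply/torsion_eqp/eqp_mull.
have nz_e : prodp e != 0 by apply: prod_irreducible_neq0.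
rewrite -(eqp_mul2l _ _ nz_e) -prod_exp_split // -hg.
by rewrite -{2}(divpK dv_dg) mulrC eqp_mull // eqp_sym.
Qed.

(** Meets and joins are determined by the order: the intersection of two U's and
any subalgebra containing both are again U's, and their exponents are compared
by [cycUS]. *)
Lemma cycU_interval_iso : interval_iso_prod_chains mul fullv B rs.
Proof.
pose box := {dffun forall i : 'I_k, 'I_(rs i).+1}.
pose expo (w : box) (i : 'I_k) : nat := w i.
have le_expo w i : (expo w i <= rs i)%N by rewrite -ltnS ltn_ord.
have expo_surj s : (forall i, (s i <= rs i)%N) -> exists w, U (expo w) = U s.
  move=> le_s; pose w : box := [ffun i => inord (s i)].
  have wE i : expo w i = s i by rewrite /expo ffunE inordK ?ltnS.
  exists w; apply: subv_anti.
  by apply/andP; split; [apply/(cycUS (le_expo w) le_s)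
    | apply/(cycUS le_s (le_expo w))] => i; rewrite wE.
have notV s : (forall i, (s i <= rs i)%N) -> subalgebra mul (U s) /\ ~~ (U s <= V)%VS.
  by move=> le_s; apply/subalgebra_notin_cycV; exists s.
have [_ bB _] := hB.
have above D : (B <= D)%VS -> ~~ (D <= V)%VS.
  move=> BD; apply: contra cycb_notin_cycV => DV.
  by rewrite memvE (subv_trans bB) // (subv_trans BD).
exists (fun w => U (expo w)).
split=> [s | D [sD BD _] | s t eq_st | s t u def_u | s t u def_u].
- by split; [case: (notV _ (le_expo s)) | apply: addvSl | apply: subvf].
- have [s le_s ->] := (subalgebra_notin_cycV D).1 (conj sD (above _ BD)).
  by have [w <-] := expo_surj _ le_s; exists w.
- apply/ffunP => i; apply/val_inj/eqP; rewrite eqn_leq.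
  rewrite /= in eq_st.
  have [le_st _] := cycUS (le_expo s) (le_expo t).
  have [le_ts _] := cycUS (le_expo t) (le_expo s).
  by apply/andP; split; [apply: le_st | apply: le_ts]; rewrite eq_st subvv.
- have [|w le_w def_w] := (subalgebra_notin_cycV (U (expo s) :&: U (expo t))%VS).1.
  + split; last by apply: above; rewrite subv_cap !addvSl.
    have [sUs _] := notV _ (le_expo s); have [sUt _] := notV _ (le_expo t).
    by move=> x y /memv_capP[? ?] /memv_capP[? ?]; rewrite memv_cap sUs ?sUt.
  apply: subv_anti; rewrite subv_cap def_w; apply/andP; split.
    apply/andP; split; [apply/(cycUS (le_expo u) (le_expo s))
      | apply/(cycUS (le_expo u) (le_expo t))] => i;
      by rewrite [expo u i]def_u ?geq_minl ?geq_minr.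
  apply/(cycUS le_w (le_expo u)) => i; rewrite [expo u i]def_u leq_min.
  have ws := capvSl (U (expo s)) (U (expo t)).
  have wt := capvSr (U (expo s)) (U (expo t)).
  rewrite def_w in ws wt.
  by rewrite ((cycUS le_w (le_expo s)).1 ws) ((cycUS le_w (le_expo t)).1 wt).
split; first by case: (notV _ (le_expo u)).
  by rewrite subv_add; apply/andP; split; [apply/(cycUS (le_expo s) (le_expo u))
    | apply/(cycUS (le_expo t) (le_expo u))] => i;
    rewrite [expo u i]def_u ?leq_maxl ?leq_maxr.
move=> D sD; rewrite subv_add => /andP[sUD tUD].
have nDV := above _ (subv_trans (addvSl _ _) sUD).
have [w le_w def_w] := (subalgebra_notin_cycV D).1 (conj sD nDV).
rewrite {}def_w {sD nDV} in sUD tUD *; apply/(cycUS (le_expo u) le_w) => i.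
rewrite [expo u i]def_u geq_max.
by rewrite ((cycUS (le_expo s) le_w).1 sUD) ((cycUS (le_expo t) le_w).1 tUD).
Qed.

End Interval.

End SubalgebraU.

End CyclicLeibniz.

Theorem theorem2p3 (F : fieldType) (L : vectType F)
  (mul : {bilinear L -> L -> L}) (hL : left_leibniz mul)
  (a : L) (ha : generated mul <[a]>%VS fullv) (hn : (1 <= \dim {:L})%N)
  (r : nat) (g : {poly F})
  (hf : lfun_char_poly (theta mul a) = 'X^r * g) (hg0 : g.[0] != 0)
  (B : {vspace L}) (hB : generated mul <[cycb mul a g]>%VS B)
  (k : nat) (p : 'I_k -> {poly F}) (rs : 'I_k -> nat)
  (hp : forall i, irreducible_poly (p i))
  (hdist : forall i j, i != j -> ~~ (p i %= p j))
  (hrs : forall i, (1 <= rs i)%N)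
  (hg : g = \prod_(i < k) p i ^+ rs i) :
  (forall D : {vspace L},
     (subalgebra mul D /\ ~~ (D <= cycV mul a)%VS) <->
     exists2 s : 'I_k -> nat,
       (forall i, (s i <= rs i)%N) & D = cycU mul a p B s)
  /\ interval_iso_prod_chains mul fullv B rs.
Proof.
split; first by move=> D; apply: (subalgebra_notin_cycV hL ha hn hf hg0 hB hp hg).
exact: (cycU_interval_iso hL ha hn hf hg0 hB hp hdist hg).
Qed.
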